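(* Let $d=d(n)\ge 0$ be integers and $p=p(n)\in[0,1]$, and for each $n$ let $G\sim G_{n,p,d}$ be drawn from any $d$-dependent random graph distribution on $n$ vertices with edge probability $p$. If $p \geq (d+1)\dfrac{\ln(n)}{n}$, then almost surely every vertex of $G$ has degree between $np - 4\sqrt{np(d+1)\ln(n)}$ and $np + 4\sqrt{np(d+1)\ln(n)}$.
   Context: A dependency graph for a finite family of random variables $(X_i)_{i\in I}$ is a (simple, undirected) graph on vertex set $I$ such that each $X_i$ is independent of the family of all $X_j$ ($j\ne i$) with $j$ not adjacent to $i$ (the notion used in the Lovász local lemma and Janson's inequality). The variables are $d$-locally dependent if they have a dependency graph of maximum degree at most $d$. A $d$-dependent random graph $G_{n,p,d}$ is any probability distribution on simple graphs on $n$ (labelled) vertices such that each of the $\binom n2$ potential edges is present with probability exactly $p$, and the indicator variables of the edges are $d$-locally dependent. The notation $G\sim G_{n,p,d}$ means $G$ is drawn from such a distribution. The parameters $p$ and $d$ may depend on $n$. An event happens almost surely if its probability tends to $1$ as $n\to\infty$. $\ln$ is the natural logarithm. *)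

(* Defs.v *)
From HB Require Import structures.
From mathcomp Require Import all_boot all_order all_algebra.
From mathcomp Require Import all_classical all_reals all_analysis.

Set Implicit Arguments.
Unset Strict Implicit.
Unset Printing Implicit Defensive.

Import Order.TTheory GRing.Theory Num.Theory.
Import numFieldNormedType.Exports.

Local Open Scope classical_set_scope.
Local Open Scope ring_scope.

Section SimpleGraphs.
Variable V : finType.

Definition edge : finType := {e : {set V} | #|e| == 2}.

(* A simple graph is its edge set.  All sets of graphs are measurable, so that
   [probability (sgraph 'I_n) R] is the type of all distributions on labelled
   simple graphs on n vertices. *)
Definition sgraph : Type := {set edge}.

HB.instance Definition _ := Finite.on sgraph.
HB.instance Definition _ := isPointed.Build sgraph (finset.set0 : {set edge}).
HB.instance Definition _ := @isMeasurable.Build default_measure_display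
  sgraph (@discrete_measurable sgraph) (@discrete_measurable0 sgraph)
  (@discrete_measurableC sgraph) (@discrete_measurableU sgraph).

Definition adj (G : sgraph) (v w : V) : bool :=
  [exists e in (G : {set edge}), val e == [set v; w]%SET].

Definition degree (G : sgraph) (v : V) : nat := #|[set w | adj G v w]%SET|.

Definition has_edge (e : edge) (G : sgraph) : bool := e \in (G : {set edge}).

Lemma measurable_has_edge (e : edge) : measurable_fun setT (has_edge e).
Proof. by []. Qed.

HB.instance Definition _ (e : edge) :=
  isMeasurableFun.Build _ _ sgraph bool (has_edge e) (measurable_has_edge e).

End SimpleGraphs.

Section LocalDependence.
Context {dT dU : measure_display} {T : measurableType dT}
  {U : measurableType dU} {R : realType}.
Variables (P : probability T R) (I : finType) (X : I -> {RV P >-> U}).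

Definition family_sigma_algebra (J : set I) : set (set T) :=
  <<s \bigcup_(j in J) g_sigma_algebra_preimage (X j) >>.

(* Joint independence: sigma(X_i) is independent of the sigma-algebra generated
   by the whole family (X_j)_(j in J), which is stronger than independence from
   each X_j separately. *)
Definition independent_of_family (i : I) (J : set I) : Prop :=
  forall A B : set T, g_sigma_algebra_preimage (X i) A ->
    family_sigma_algebra J B -> P (A `&` B) = (P A * P B)%E.

Definition dependency_graph (D : sgraph I) : Prop :=
  forall i : I,
    independent_of_family i [set j | j != i /\ ~~ adj D i j].

Definition locally_dependent (d : nat) : Prop :=
  exists D : sgraph I,
    dependency_graph D /\ forall i : I, (degree D i <= d)%N.

End LocalDependence.

Definition dependent_random_graph (R : realType) (n : nat) (p : R) (d : nat)
    (P : probability (sgraph 'I_n) R) : Prop :=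
  (forall e : edge 'I_n, P [set G | has_edge e G] = p%:E) /\
  locally_dependent
    (fun e : edge 'I_n => has_edge e : {RV P >-> bool}) d.

(* Main.v *)
Require Import Defs.
From mathcomp Require Import all_boot all_order all_algebra.
From mathcomp Require Import all_classical all_reals all_analysis.
From mathcomp Require Import ring lra.
Import Order.TTheory GRing.Theory Num.Theory.
Import numFieldNormedType.Exports.
Local Open Scope classical_set_scope.
Local Open Scope ring_scope.

Set Implicit Arguments.
Unset Strict Implicit.

(** The edges at a vertex have at most [d] neighbours each in the dependency
    graph, so that graph has a proper colouring with [d + 1] colours, and
    the edge indicators inside a colour class are mutually independent. Each
    class thus satisfies the Chernoff exponential moment bound for a
    binomial variable; the classes, which may depend on each other
    arbitrarily, are combined by convexity of [exp], so the degree satisfies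
    a Chernoff bound in which the exponent is divided by [d + 1]. The
    parameter [s = sqrt ((d + 1) ln n / (n p))], which is at most 1 by the
    assumption on [p], makes each tail [O(n^-2)], and a union bound over the
    vertices leaves [O(1/n)]. *)

(** * Greedy colouring and a quadratic bound on the exponential *)

Lemma greedy_coloring (T : finType) (r : rel T) (d : nat) :
  symmetric r -> (forall x, (#|[set y | r x y]%SET| <= d)%N) ->
  exists col : T -> 'I_d.+1, forall x y, x != y -> r x y -> col x != col y.
Proof.
move=> rC rd.
suff [col colP] : exists col : T -> 'I_d.+1, forall x y,
    x \in enum T -> y \in enum T -> x != y -> r x y -> col x != col y.
  by exists col => x y; apply: colP; rewrite mem_enum.
elim: (enum T) => [|a s [col colP]]; first by exists (fun=> ord0).
(* The neighbours of [a], listed or not, use at most [d] of the [d.+1] colours, so some colour [c]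
   is free for [a]. *)
have /card_gt0P[c] : (0 < #|~: (col @: [set y | r a y]%SET)|)%N.
  rewrite cardsCs finset.setCK card_ord subn_gt0 ltnS.
  exact: leq_trans (leq_imset_card _ _) (rd a).
rewrite inE => cN.
have cP y : r a y -> col y != c.
  by move=> ray; apply: contra cN => /eqP <-; apply/imset_f; rewrite inE.
exists (fun x => if x == a then c else col x) => x y.
rewrite !inE; have [->|xa] := eqVneq x a; have [->|ya] := eqVneq y a => //=.
- by move=> _ _ _ /cP; rewrite eq_sym.
- by move=> _ _ _; rewrite rC => /cP.
- exact: colP.
Qed.

(** Squaring [1 - s / 2 <= expR (- (s / 2))] bounds [expR s] by the inverse of [(1 - s / 2) ^+ 2].
    Negative [s] is included because the lower tail uses it. *)
Lemma expR_le_quadratic (R : realType) (s : R) :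
  s <= 1 -> expR s <= 1 + s + 2 * s ^+ 2.
Proof.
move=> s1; have h : 1 - s / 2 <= expR (- (s / 2)) by exact: expR_ge1Dx.
have e : expR s * expR (- (s / 2)) ^+ 2 = 1.
  by rewrite -expRM_natl -expRD -[RHS]expR0; congr expR; field.
have h2 : (1 - s / 2) ^+ 2 <= expR (- (s / 2)) ^+ 2.
  by apply: lerXn2r; rewrite ?nnegrE ?expR_ge0//; lra.
have : expR s * (1 - s / 2) ^+ 2 <= 1.
  by apply: le_trans (ler_wpM2l (expR_ge0 s) h2) _; rewrite e.
have q : 0 < (1 - s / 2) ^+ 2 by apply: exprn_gt0; lra.
rewrite -ler_pdivlMr// => /le_trans; apply.
rewrite ler_pdivrMr//.
have -> : (1 + s + 2 * s ^+ 2) * (1 - s / 2) ^+ 2 =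
  1 + s ^+ 2 * ((1 - s) * (5 / 4 - s / 2)) by field.
rewrite lerDl mulr_ge0 ?sqr_ge0// mulr_ge0; lra.
Qed.

(** * Chernoff bound over colour classes *)

Section ColoredChernoff.
Context {R : realType} {T I : finType}.
Variables (w : T -> R) (X : I -> pred T) (p : R).

(** The product is multilinear in the indicators, so its expectation involves only the joint moments
    in the hypothesis. With [c = expR s - 1] it is the exponential moment of a binomial variable. *)
Lemma sum_prod_affine (C : {set I}) (c : R) :
  (forall S : {set I}, S \subset C ->
    \sum_(x | [forall i in S, X i x]) w x = p ^+ #|S|) ->
  \sum_x w x * \prod_(i in C) (1 + c * (X i x)%:R) = (1 + c * p) ^+ #|C|.
Proof.
move=> wS.
(* Restricting the sum to the event of [S] closes the induction: expanding the factor of [a] gives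
   one sum over the same event and one with [a] added to [S]. *)
suff gen (t : seq I) (S : {set I}) : uniq t -> {subset t <= C} ->
    S \subset C -> (forall i, i \in t -> i \notin S) ->
    \sum_(x | [forall i in S, X i x])
      w x * \prod_(i <- t) (1 + c * (X i x)%:R)
    = p ^+ #|S| * (1 + c * p) ^+ size t.
  have := gen (enum C) finset.set0 (enum_uniq _) _ (finset.sub0set _) _.
  rewrite cards0 expr0 mul1r -cardE => <- //; last first.
  - by move=> i _; rewrite inE.
  - by move=> i; rewrite mem_enum.
  apply: eq_big => [x|x _]; last by rewrite big_enum.
  by apply/esym/forallP => i; rewrite inE.
elim: t S => [|a t IH] S /=.
  by move=> _ _ SC _; rewrite expr0 mulr1 -(wS _ SC); apply: eq_bigr => x _;
     rewrite big_nil mulr1.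
move=> /andP[aNt ut] atC SC atS.
have aC : a \in C by apply: atC; rewrite mem_head.
have tC : {subset t <= C} by move=> i it; apply: atC; rewrite inE it orbT.
have tS i : i \in t -> i \notin S by move=> it; apply: atS; rewrite inE it orbT.
have aS : a \notin S by apply: atS; rewrite mem_head.
have := IH (a |: S)%SET ut tC _ _.
rewrite finset.subUset finset.sub1set aC SC => /(_ isT) IHa.
under eq_bigr do rewrite big_cons mulrCA mulrDl mul1r -mulrA.
rewrite big_split /= IH// -mulr_sumr.
rewrite (_ : \sum_(_ | _) _ = p ^+ #|(a |: S)%SET| * (1 + c * p) ^+ size t).
  by rewrite cardsU1 aS !exprS; ring.
rewrite -IHa; last first.
  move=> i it; rewrite !inE negb_or tS// andbT.
  by apply: contra aNt => /eqP <-.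
rewrite [LHS]big_mkcond [RHS]big_mkcond; apply: eq_bigr => x _.
have -> : [forall i in (a |: S)%SET, X i x] = X a x && [forall i in S, X i x].
  apply/forall_inP/andP => [h|[Xa /forall_inP h] i].
    split; first by apply: h; rewrite !inE eqxx.
    by apply/forall_inP => i iS; apply: h; rewrite !inE iS orbT.
  by rewrite !inE => /orP[/eqP -> //|]; exact: h.
by case: ifP => _; case: (X a x); rewrite /= ?mul1r ?mul0r.
Qed.

Lemma chernoff_colored (k : nat) (col : I -> 'I_k.+1) (C : {set I}) (s a : R) :
  (forall x, 0 <= w x) -> 0 <= p <= 1 -> s <= 1 ->
  (forall S : {set I}, (forall i j, i \in S -> j \in S -> col i = col j) ->
    \sum_(x | [forall i in S, X i x]) w x = p ^+ #|S|) ->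
  \sum_(x | a <= s * (#|[set i in C | X i x]%SET|%:R - #|C|%:R * p)) w x
    <= expR ((2 * #|C|%:R * p * s ^+ 2 - a) / k.+1%:R).
Proof.
move=> w0 /andP[p0 p1] s1 wS.
(* Per variable, [1 + (expR s - 1) * p <= 1 + b <= expR b]. Subtracting [b] once for each element of
   the class brings the exponential moment of [y j] down to at most 1. *)
set b := p * s + 2 * p * s ^+ 2.
pose D j := [set i in C | col i == j]%SET.
pose y j x := s * (\sum_(i in D j) (X i x)%:R) - #|D j|%:R * b.
set L := (a - 2 * #|C|%:R * p * s ^+ 2) / k.+1%:R.
have k0 : 0 < k.+1%:R :> R by rewrite ltr0n.
have Ey j : \sum_x w x * expR (y j x) <= 1.
  have -> : \sum_x w x * expR (y j x) =
      expR (- b) ^+ #|D j| * (1 + (expR s - 1) * p) ^+ #|D j|.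
    rewrite -sum_prod_affine; last first.
      move=> S /fintype.subsetP SD; apply: wS => i i' /SD + /SD.
      by rewrite !inE => /andP[_ /eqP ->] /andP[_ /eqP ->].
    rewrite mulr_sumr; apply: eq_bigr => x _.
    rewrite mulrCA; congr (_ * _).
    rewrite /y expRD mulrC -mulrN expRM_natl; congr (_ * _).
    rewrite mulr_sumr expR_sum; apply: eq_bigr => i _.
    by case: (X i x); rewrite ?mulr1 ?mulr0 ?expR0 ?addr0 // addrC subrK.
  rewrite -exprMn exprn_ile1//.
    rewrite mulr_ge0 ?expR_ge0//.
    rewrite (_ : 1 + _ = (1 - p) + expR s * p); last by ring.
    by rewrite addr_ge0 ?subr_ge0// mulr_ge0 ?expR_ge0.
  rewrite expRN mulrC ler_pdivrMr ?expR_gt0// mul1r.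
  apply: le_trans (expR_ge1Dx b); rewrite lerD2l.
  have h : expR s - (1 + s + 2 * s ^+ 2) <= 0.
    by rewrite subr_le0 expR_le_quadratic.
  rewrite -subr_le0 (_ : _ - b = (expR s - (1 + s + 2 * s ^+ 2)) * p).
    by rewrite mulr_le0_ge0.
  by rewrite /b; ring.
have cardD : \sum_j #|D j|%:R = #|C|%:R :> R.
  rewrite -sum1_card natr_sum (partition_big col predT)//=.
  apply: eq_bigr => j _; rewrite -sum1_card natr_sum.
  by apply: eq_bigl => i; rewrite inE.
have sumy x : \sum_j y j x = s * #|[set i in C | X i x]%SET|%:R - #|C|%:R * b.
  rewrite sumrB -mulr_sumr -mulr_suml cardD; congr (s * _ - _).
  rewrite -sum1_card natr_sum (partition_big col predT)//=.
  apply: eq_bigr => j _; rewrite [LHS]big_mkcond [RHS]big_mkcond.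
  apply: eq_bigr => i _; rewrite !inE.
  by case: (i \in C); case: (X i x); case: (col i == j).
(* Jensen's inequality via the tangent of [expR] at [L], a lower bound for the
   average of the [y j x] over the colours [j]. *)
have avg x : a <= s * (#|[set i in C | X i x]%SET|%:R - #|C|%:R * p) ->
    k.+1%:R * expR L <= \sum_j expR (y j x).
  move=> ax.
  have tangent j : expR L * (1 + (y j x - L)) <= expR (y j x).
    rewrite -[X in _ <= expR X](subrKC L) expRD.
    by rewrite ler_pM2l ?expR_gt0 ?expR_ge1Dx.
  apply: le_trans (ler_sum _ (fun j _ => tangent j)).
  rewrite -mulr_sumr mulrC ler_pM2l ?expR_gt0// big_split/= sumrB sumy.
  rewrite !sumr_const card_ord -[L *+ _]mulr_natr /L divfK ?gt_eqF//.
  rewrite lerDl /b; lra.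
rewrite (_ : _ / _ = - L); last by rewrite /L -mulNr opprB.
rewrite expRN -[leRHS]mul1r ler_pdivlMr ?expR_gt0// -(ler_pM2l k0) mulr1.
rewrite mulrCA mulr_suml.
(* Markov's inequality: on the tail event the sum of the [expR (y j x)] is at least
   [k.+1%:R * expR L], while its expectation is at most [k.+1%:R]. *)
have step1 : \sum_(x | a <= s * (#|[set i in C | X i x]%SET|%:R - #|C|%:R * p))
    w x * (k.+1%:R * expR L) <= \sum_x \sum_j w x * expR (y j x).
  rewrite [leLHS]big_mkcond; apply: ler_sum => x _; rewrite -mulr_sumr.
  case: ifPn => [/avg h|_]; first by rewrite ler_wpM2l.
  by rewrite mulr_ge0// sumr_ge0// => j _; rewrite expR_ge0.
apply: le_trans step1 _; rewrite exchange_big /=.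
apply: le_trans (ler_sum _ (fun j _ => Ey j)) _.
by rewrite sumr_const card_ord.
Qed.
End ColoredChernoff.

(** * Joint probabilities of pairwise non-adjacent edges *)

Section DiscreteProbability.
Context {R : realType} {n : nat}.
Variable P : probability (sgraph 'I_n) R.

(** Turns [P] into the point weights that [chernoff_colored] takes as [w]. *)
Lemma probability_sgraphE (Q : pred (sgraph 'I_n)) :
  P [set G : sgraph 'I_n | Q G] = (\sum_(G | Q G) fine (P [set G]))%:E.
Proof.
suff gen (s : seq (sgraph 'I_n)) : uniq s ->
    P [set G : sgraph 'I_n | (G \in s) && Q G] =
    (\sum_(G <- s | Q G) fine (P [set G]))%:E.
  rewrite -gen ?index_enum_uniq//; congr (P _).
  by apply/seteqP; split=> G /=; rewrite mem_index_enum.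
elim: s => [_|G s IH /= /andP[Gs us]].
  by rewrite big_nil (_ : [set _ | _] = set0) ?measure0//; apply/seteqP; split.
rewrite big_cons; case: ifPn => QG; last first.
  rewrite -IH//; congr (P _); apply/seteqP; split=> H /=; rewrite inE.
    by move=> /andP[/orP[/eqP->|->]]//; rewrite (negbTE QG).
  by move=> /andP[-> ->]; rewrite orbT.
rewrite EFinD fineK ?fin_num_measure// -IH// -measureU//.
- congr (P _); apply/seteqP; split=> H /=; rewrite inE.
    by move=> /andP[/orP[/eqP->|->]]//; [left|right].
  by move=> [->|/andP[-> ->]]; rewrite ?eqxx ?orbT.
- by apply/seteqP; split=> H //= [-> /andP[]]; rewrite (negbTE Gs).
Qed.

(** Edges are split off [S] one at a time: the remaining ones are non-neighbours of [e], so the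
    event that they are all present lies in the sigma-algebra from which [e] is independent. *)
Lemma probability_has_edges (p : R) (D : sgraph (edge 'I_n))
    (S : {set edge 'I_n}) :
  (forall e, P [set G : sgraph 'I_n | has_edge e G] = p%:E) ->
  dependency_graph
    (fun e : edge 'I_n => has_edge e : {RV P >-> bool}) D ->
  (forall e f, e \in S -> f \in S -> e != f -> ~~ adj D e f) ->
  P [set G : sgraph 'I_n | [forall e in S, has_edge e G]] = (p ^+ #|S|)%:E.
Proof.
move=> Pp dep; have [m] := ubnP #|S|; elim: m S => // m IH S.
have [->|[e eS]] := set_0Vmem S.
  move=> _ _; rewrite cards0 expr0 (_ : [set _ | _] = setT) ?probability_setT//.
  by apply/seteqP; split=> G //= _; apply/forall_inP => e; rewrite inE.
rewrite (cardsD1 e) eS add1n ltnS => Sm indep.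
rewrite exprS EFinM -(Pp e) -IH//; last first.
  by move=> f g /setD1P[_ fS] /setD1P[_ gS]; exact: indep.
rewrite -(dep e); first last.
(* The event is a finite intersection of generators; listing the edges allows an induction. *)
- have gen (s : seq (edge 'I_n)) : {subset s <= S :\ e} ->
      family_sigma_algebra
        (fun e : edge 'I_n => has_edge e : {RV P >-> bool})
        [set f | f != e /\ ~~ adj D e f]
        [set G : sgraph 'I_n | all (fun f => has_edge f G) s].
    elim: s => [_|f s IHs fsS] /=.
      have -> : [set _ : sgraph 'I_n | true] = setT by apply/seteqP; split.
      exact: (@measurableT _ (g_sigma_algebraType _)).
    have /setD1P[fe fS] : f \in S :\ e by apply: fsS; rewrite mem_head.
    have -> : [set G : sgraph 'I_n |
          has_edge f G && all (fun f => has_edge f G) s] =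
        [set G | has_edge f G] `&` [set G | all (fun f => has_edge f G) s].
      by apply/seteqP; split=> G /= => [/andP[]|[-> ->]].
    apply: (@measurableI _ (g_sigma_algebraType _)); last first.
      by apply: IHs => g gs; apply: fsS; rewrite inE gs orbT.
    apply: sub_sigma_algebra; exists f.
      by split=> //; apply: indep => //; rewrite eq_sym.
    exists [set true] => //; rewrite setTI.
    by apply/seteqP; split=> G /= => [->|].
  rewrite (_ : [set G : sgraph 'I_n | [forall f in S :\ e, has_edge f G]] =
      [set G | all (fun f => has_edge f G) (enum (S :\ e))]).
    by apply: gen => f; rewrite mem_enum.
  apply/seteqP; split=> G /=.
    by move=> /forall_inP h; apply/allP => f; rewrite mem_enum; exact: h.
  by move=> /allP h; apply/forall_inP => f fS; apply: h; rewrite mem_enum.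
- exists [set true] => //; rewrite setTI.
  by apply/seteqP; split=> G /= => [->|].
congr (P _); apply/seteqP; split=> G /=.
  move=> /forall_inP h; split; first exact: h.
  by apply/forall_inP => f /setD1P[_]; exact: h.
move=> [eG /forall_inP h]; apply/forall_inP => f fS.
by have [->//|fe] := eqVneq f e; apply: h; rewrite !inE fe.
Qed.
End DiscreteProbability.

(** * Edges at a vertex *)

Section Star.
Context {V : finType}.
Implicit Types (v w : V) (e : edge V) (G : sgraph V).

Definition star v : {set edge V} := [set e : edge V | v \in val e]%SET.

(** The default [v] is never reached, since an edge keeps an element when [v] is removed. *)
Definition opposite v (e : edge V) : V := odflt v [pick w in val e :\ v].

Lemma oppositeP v e : e \in star v ->
  opposite v e != v /\ val e = [set v; opposite v e]%SET.
Proof.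
rewrite inE => ve; have := eqP (valP e).
rewrite (cardsD1 v) ve add1n => -[/eqP/cards1P[w ew]].
have -> : opposite v e = w.
  rewrite /opposite ew; case: pickP => [u|/(_ w)]; last by rewrite inE eqxx.
  by rewrite inE => /eqP.
split; last by rewrite -(finset.setD1K ve) ew.
by have := finset.set11 w; rewrite -ew !inE => /andP[].
Qed.

(** [opposite v] maps the present edges at [v] bijectively onto the neighbours of [v]. *)
Lemma degreeE G v : degree G v = #|[set e in star v | has_edge e G]%SET|.
Proof.
rewrite -(@card_in_imset _ _ (opposite v)).
  apply: eq_card => w; rewrite inE; apply/existsP/imsetP.
    move=> [e /andP[eG /eqP evw]]; exists e.
      by rewrite !inE evw !inE eqxx.
    have /oppositeP[ov ee] : e \in star v by rewrite inE evw !inE eqxx.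
    have : opposite v e \in val e by rewrite ee !inE eqxx orbT.
    by rewrite evw !inE (negbTE ov) => /eqP.
  move=> [e]; rewrite inE => /andP[/oppositeP[_ ee] eG ->]; exists e.
  by rewrite [_ \in _]eG -ee eqxx.
move=> e f; rewrite !inE => /andP[ve _] /andP[vf _] oef; apply: val_inj.
have /oppositeP[_ ee] : e \in star v by rewrite inE.
have /oppositeP[_ ef] : f \in star v by rewrite inE.
by rewrite ee ef oef.
Qed.

(** Read off from [degreeE] in the complete graph, where every vertex but [v] is a neighbour. *)
Lemma card_star v : #|star v| = #|V|.-1.
Proof.
have := degreeE finset.setT v.
rewrite (_ : [set e in star v | _]%SET = star v); last first.
  by apply/setP => e; rewrite !inE /has_edge inE andbT.
move=> <-; rewrite /degree (_ : [set w | _]%SET = ~: [set v])%SET ?cardsC1//.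
apply/setP => w; rewrite !inE; apply/existsP/idP.
  move=> [e /andP[_ /eqP evw]]; have := valP e; rewrite evw cards2.
  by rewrite (eq_sym v); case: (w == v).
move=> wv; have h : #|[set v; w]%SET| == 2 by rewrite cards2 (eq_sym v) wv.
by exists (Sub [set v; w]%SET h); rewrite inE/=.
Qed.
End Star.

(** * Degree tails, union bound and limit *)

Lemma degree_tail {R : realType} {n : nat} (p : R) (d : nat)
    (P : probability (sgraph 'I_n) R) (v : 'I_n) (s a : R) :
  0 <= p <= 1 -> dependent_random_graph p d P -> s <= 1 ->
  (P [set G | a <= s * ((degree G v)%:R - n.-1%:R * p)]%R
    <= (expR ((2 * n.-1%:R * p * s ^+ 2 - a) / d.+1%:R))%:E)%E.
Proof.
move=> p01 [Pp [D [dep degD]]] s1.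
have [col colP] : exists col : edge 'I_n -> 'I_d.+1,
    forall e f, e != f -> adj D e f -> col e != col f.
  apply: greedy_coloring => [e f|//].
  by apply: eq_existsb => g; rewrite finset.setUC.
have := @chernoff_colored R _ _ (fun G => fine (P [set G])) (@has_edge _) p
  d col (star v) s a _ p01 s1 _.
rewrite card_star card_ord probability_sgraphE lee_fin.
under eq_bigl do rewrite -degreeE; apply.
  by move=> G; rewrite fine_ge0.
move=> S mono; apply: EFin_inj; rewrite -probability_sgraphE.
(* A monochromatic set of edges is independent in [D]. *)
apply: (probability_has_edges Pp dep) => e f eS fS ef.
by apply: contraTN (introT eqP (mono _ _ eS fS)) => /(colP _ _ ef).
Qed.

Lemma probability_bigsetU {d} {T : measurableType d} {R : realType}
    (P : probability T R) (I : Type) (r : seq I) (F : I -> set T) :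
  (forall i, measurable (F i)) ->
  (P (\big[setU/set0]_(i <- r) F i) <= \sum_(i <- r) P (F i))%E.
Proof.
move=> mF; elim: r => [|i r IH]; first by rewrite !big_nil measure0.
rewrite !big_cons; apply: le_trans (measureU2 _ _ _) _ => //.
  exact: bigsetU_measurable.
exact: leeD.
Qed.

Lemma degree_concentration {R : realType} {n : nat} (p : R) (d : nat)
    (P : probability (sgraph 'I_n) R) :
  (1 < n)%N -> 0 <= p <= 1 -> dependent_random_graph p d P ->
  (d + 1)%:R * (ln n%:R / n%:R) <= p ->
  ((1 - (1 + expR 1) / n%:R)%:E <= P [set G : sgraph 'I_n | forall v : 'I_n,
         (n%:R * p - 4 * Num.sqrt (n%:R * p * (d + 1)%:R * ln n%:R)
           <= (degree G v)%:R
           <= n%:R * p + 4 * Num.sqrt (n%:R * p * (d + 1)%:R * ln n%:R))%R])%E.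
Proof.
move=> n1 p01 PG; rewrite addn1 => hp.
have n0 : 0 < n%:R :> R by rewrite ltr0n; apply: ltn_trans n1.
set k := d.+1%:R : R; set l := ln n%:R.
have k0 : 0 < k by rewrite ltr0n.
have k1 : 1 <= k by rewrite ler1n.
have l0 : 0 < l by rewrite ln_gt0// ltr1n.
have kl0 : 0 < k * l by rewrite mulr_gt0.
have klnp : k * l <= n%:R * p by rewrite [leRHS]mulrC -ler_pdivrMr// -mulrA.
have np0 : 0 < n%:R * p by exact: lt_le_trans klnp.
have p0 : 0 < p by rewrite -(pmulr_rgt0 _ n0).
(* With these choices [s * a] and [n%:R * p * s ^+ 2] both equal [k * l]. A deviation of [4 * a]
   thus contributes [- 4 * (k * l)] against a quadratic term of at most [2 * (k * l)], and division
   by [k] leaves [- 2 * l]. *)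
set s := Num.sqrt (k * l / (n%:R * p)).
set a := Num.sqrt (n%:R * p * k * l).
have s0 : 0 <= s by exact: sqrtr_ge0.
have s1 : s <= 1.
  by rewrite -[leRHS]sqrtr1 ler_sqrt// ler_pdivrMr// mul1r.
have nps : n%:R * p * s ^+ 2 = k * l.
  by rewrite sqr_sqrtr ?divr_ge0 ?ltW// mulrC divfK ?gt_eqF.
have sa : s * a = k * l.
  rewrite -[RHS]gtr0_norm// -sqrtr_sqr /s /a -sqrtrM ?divr_ge0 ?ltW//.
  by congr Num.sqrt; field; rewrite !gt_eqF.
have n1E : n.-1%:R = n%:R - 1 :> R.
  by rewrite -[in RHS](ltn_predK n1) -natr1 addrK.
have expRl c : expR (- 2 * l + c) = n%:R ^- 2 * expR c.
  by rewrite expRD mulNr expRN expRM_natl lnK.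
have mps : n.-1%:R * p * s ^+ 2 <= k * l.
  by rewrite -nps ler_wpM2r ?sqr_ge0// ler_wpM2r ?ltW// n1E; lra.
pose U v := [set G : sgraph 'I_n | n%:R * p + 4 * a < (degree G v)%:R].
pose L v := [set G : sgraph 'I_n | (degree G v)%:R < n%:R * p - 4 * a].
have PU v : (P (U v) <= (n%:R ^- 2)%:E)%E.
  apply: le_trans (le_trans (degree_tail v (4 * (k * l)) p01 PG s1) _).
    apply: le_measure; rewrite ?inE// /U => G /= UG.
    rewrite -sa mulrCA ler_wpM2l// n1E; lra.
  have := expRl 0; rewrite expR0 mulr1 lee_fin => <-.
  by rewrite ler_expR ler_pdivrMr//; lra.
(* The tail bound is centred at [n.-1%:R * p], which shortens the lower deviation by [p]. As
   [s * p <= 1], the threshold drops by at most 1, whence the factor [expR 1]. *)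
have PL v : (P (L v) <= (n%:R ^- 2 * expR 1)%:E)%E.
  have Ns1 : - s <= 1 by lra.
  apply: le_trans (le_trans (degree_tail v (4 * (k * l) - 1) p01 PG Ns1) _).
    apply: le_measure; rewrite ?inE// /L => G /= LG.
    have h : s * (4 * a - p) <= s * (n.-1%:R * p - (degree G v)%:R).
      by rewrite ler_wpM2l// n1E; lra.
    have sp : s * p <= 1 by have /andP[? ?] := p01; rewrite mulr_ile1.
    lra.
  rewrite lee_fin -expRl ler_expR sqrrN ler_pdivrMr//; lra.
set good := [set _ | _].
have -> : good = ~` (\big[setU/set0]_(v < n) (U v `|` L v)).
  rewrite -bigcup_seq setC_bigcup; apply/seteqP; split=> G /= h v.
    move=> _; have /andP[h1 h2] := h v.
    by move=> []; rewrite /U /L /= ltNge ?h1 ?h2.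
  have := h v (mem_index_enum v).
  by move=> /not_orP[/negP + /negP]; rewrite -!leNgt => -> ->.
rewrite probability_setC// EFinB leeB//.
apply: (@le_trans _ _ (\sum_(v < n) (n%:R ^- 2 * (1 + expR 1))%:E)%E).
  apply: le_trans (probability_bigsetU _ _ _) _ => //.
  apply: lee_sum => v _; apply: le_trans (measureU2 _ _ _) _ => //.
  by rewrite mulrDr mulr1 EFinD; exact: leeD (PU v) (PL v).
rewrite sumEFin sumr_const card_ord lee_fin -[leLHS]mulr_natl.
rewrite le_eqVlt; apply/orP; left; apply/eqP; field; exact: lt0r_neq0.
Qed.

Theorem theorem2 (R : realType) (d : nat -> nat) (p : nat -> R)
    (P : forall n : nat, probability (sgraph 'I_n) R)
    (p01 : forall n : nat, 0 <= p n <= 1)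
    (PG : forall n : nat, dependent_random_graph (p n) (d n) (P n))
    (hp : \forall n \near \oo, (d n + 1)%:R * (ln n%:R / n%:R) <= p n) :
  P n [set G : sgraph 'I_n | forall v : 'I_n,
         n%:R * p n - 4 * Num.sqrt (n%:R * p n * (d n + 1)%:R * ln n%:R)
           <= (degree G v)%:R
           <= n%:R * p n + 4 * Num.sqrt (n%:R * p n * (d n + 1)%:R * ln n%:R)]
    @[n --> \oo] --> 1%E.
Proof.
apply: (@squeeze_cvge _ _ _ _
  (fun n => (1 - (1 + expR 1) / n%:R : R)%:E) _ (cst 1%E)).
(* The lower bound holds only eventually: the assumption on [p] is eventual, and [1 < n] makes
   [ln n%:R] positive. *)
- near=> n; rewrite probability_le1// andbT.
  apply: degree_concentration => //; last by near: n.
  by near: n; exists 2%N.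
- apply: cvg_EFin; first by near=> n.
  have -> : fine \o (fun n => (1 - (1 + expR 1) / n%:R : R)%:E) =
      (fun n => 1 - (1 + expR 1) * n%:R^-1) by [].
  rewrite -[X in _ --> X]subr0 -[X in _ - X](mulr0 (1 + expR 1)).
  apply: cvgB; first exact: cvg_cst.
  apply: cvgMl_tmp.
  apply/gtr0_cvgV0; last exact: cvgr_idn.
  by near=> n; rewrite ltr0n; near: n; exists 1%N.
- exact: cvg_cst.
Unshelve. all: by end_near.
Qed.
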